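(* Let $n \ge 1$ and $V = \mathbb{C}^n$. Let $B_1,\ldots,B_n$ be $n$ bases of $V$. Then there exist an integer $\ell \ge 1$ and an $n \times \ell n$ matrix $A$ whose entries are vectors of $V$ such that: (1) for each $i = 1,\ldots,n$, each element of $B_i$ appears exactly $\ell$ times in the $i$-th row of $A$ (so every entry of the $i$-th row is an element of $B_i$); (2) for every column of $A$, the $n$ vectors in that column form a basis of $V$.
   Context: The bases $B_1,\ldots,B_n$ are arbitrary (they may share elements or coincide); each has exactly $n$ elements. The $i$-th row of $A$ has $\ell n$ entries. *)

(* Defs.v *)
(* The field of complex numbers is rendered as [R[i]] for an arbitrary
   [R : realType] (a complete archimedean ordered field, unique up to
   isomorphism), so that C^n is the R[i]-vector space ['cV[R[i]]_n]. *)
From HB Require Import structures.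
From mathcomp Require Import all_boot all_order all_algebra.
From mathcomp Require Import reals.
From mathcomp Require Import complex.

(* Main.v *)
Require Import Defs.
From HB Require Import structures.
From mathcomp Require Import all_boot all_order all_algebra.
From mathcomp Require Import reals.
From mathcomp Require Import complex.
From mathcomp Require Import zify lra.
Set Implicit Arguments.
Unset Strict Implicit.
Unset Printing Implicit Defensive.
Import Order.TTheory GRing.Theory Num.Theory.
Local Open Scope ring_scope.
Local Open Scope complex_scope.

(** The columns of [A] are transversals of [B_1, ..., B_n] that are bases of
[V], taken with multiplicities.  So it is enough to write the weight that is
constantly 1 on the [n * n] pairs (row, basis vector) as a combination, with
nonnegative rational coefficients, of indicators of transversal bases:
clearing denominators turns the coefficients into numbers of columns, and
the weight 1 into [l].

Such a combination exists for every rational weight [x >= 0] that has the same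
total [k] in each row and satisfies [x {e | v e \in W} <= k * dim W] for all
subspaces [W] ([feasible_conic_comb]).  These conditions are clearly necessary;
that they suffice is the linear case of Edmonds' matroid intersection theorem,
for a partition matroid.  The weight 1 satisfies them with [k = n], because a
basis has at most [dim W] elements in [W] ([feasible_bases]).

The proof removes one transversal basis [T] at a time from [x].  Rado's theorem
([rado_transversal]) provides [T] inside the support of [x].  Removing a
multiple of [T] lowers both sides of the condition at [W], by amounts
proportional to the number of elements of [T] in [W] and to [dim W], so the
condition survives a small step as long as [T] has exactly [dim W] elements in
each subspace [W] where it is an equality.  The largest possible step
([feasible_peel]) either kills a coordinate of [x], or makes the condition an
equality at a new [W] where [T] has the wrong number of elements.

If [T] has the wrong number of elements in some tight [W], the vectors are
degenerated along [W]: each [v e] outside [W] is replaced with its component in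
a complement of [W].  Tightness of [W] makes the weight stay feasible
([degen_feasible]), every basis for the new vectors is a basis for the old ones
and has exactly [dim W] elements in [W] ([degen_basis]), so that [T] is a basis
no more.  In all cases the number of transversal bases supported by [x] drops,
and induction on this number concludes. *)

(** * Independent transversals *)

(** Rado's theorem.  As long as some [A i0] has two elements [a] and [b], one of
the two can be deleted without breaking the dimension condition.  Otherwise some
[P] and [Q] containing [i0] block the two deletions, and the modular law for the
two spans, compared with the condition at [P :|: Q] and at [(P :&: Q) :\ i0],
gives a contradiction.  When every [A i] is a singleton, the condition at the
full set is the conclusion. *)
Lemma rado_transversal (K : fieldType) (vT : vectType K) (I E : finType)
    (v : E -> vT) (A : I -> {set E}) :
  (forall P : {set I},
     #|P| <= \dim (\sum_(i in P) \sum_(e in A i) <[v e]>)%VS)%N ->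
  exists T : {ffun I -> E},
    (forall i, T i \in A i) /\ (#|I| <= \dim (\sum_i <[v (T i)]>)%VS)%N.
Proof.
have [m] := ubnP (\sum_i #|A i|); elim: m A => // m IHm A ltAm radoA.
have [/forallP A1|] := boolP [forall i, #|A i| <= 1]%N.
  have A0 i : exists e, A i == [set e].
    suff /cards1P[e ->] : #|A i| == 1%N by exists e.
    rewrite eqn_leq A1 card_gt0; apply/negP => /eqP Ai0.
    by have := radoA [set i]; rewrite cards1 big_set1 Ai0 big_set0 dimv0.
  exists [ffun i => xchoose (A0 i)]; split=> [i|].
    by rewrite ffunE {2}(eqP (xchooseP (A0 i))) set11.
  have := radoA setT; rewrite cardsT; congr (_ <= \dim _)%N.
  apply: eq_big => [i|i _]; first by rewrite inE.
  by rewrite ffunE {1}(eqP (xchooseP (A0 i))) big_set1.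
rewrite negb_forall => /existsP[i0]; rewrite -ltnNge => /card_gt1P[a [b [Aa Ab neq_ab]]].
pose D c i := if i == i0 then A i0 :\ c else A i.
pose S (F : I -> {set E}) (P : {set I}) := (\sum_(i in P) \sum_(e in F i) <[v e]>)%VS.
(* The condition can only fail at sets containing i0, since the other classes
   are unchanged. *)
have del c : c \in A i0 ->
    (forall P : {set I}, #|P| <= \dim (S (D c) P))%N \/
    exists2 P : {set I}, i0 \in P & (\dim (S (D c) P) < #|P|)%N.
  move=> Ac; have [/forallP|] := boolP [forall P : {set I}, #|P| <= \dim (S (D c) P)]%N.
    by left.
  rewrite negb_forall => /existsP[P]; rewrite -ltnNge => ltP; right; exists P => //.
  apply: contraLR ltP => i0P; rewrite -leqNgt (leq_trans (radoA P)) //.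
  rewrite /S; under [X in (_ <= \dim X)%N]eq_bigr => i iP.
    have /negPf nii0 : i != i0 by apply: contraNneq i0P => <-.
    rewrite /D nii0; over.
  by [].
have fin c : c \in A i0 -> (forall P : {set I}, #|P| <= \dim (S (D c) P))%N ->
    exists T : {ffun I -> E},
    (forall i, T i \in A i) /\ (#|I| <= \dim (\sum_i <[v (T i)]>)%VS)%N.
  move=> Ac radoD; have [|T [TD Tfree]] := IHm (D c) _ radoD.
    rewrite -ltnS (leq_trans _ ltAm) // ltnS (bigD1 i0) //= [X in (_ < X)%N](bigD1 i0) //=.
    rewrite /D eqxx [in X in (_ < X)%N](cardsD1 c) Ac ltnS leq_add2l.
    by apply: leq_sum => i /negPf->.
  exists T; split=> // i; have := TD i; rewrite /D; case: eqP => // ->.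
  by rewrite !inE => /andP[].
have [/(fin a Aa)//|[P i0P ltP]] := del a Aa.
have [/(fin b Ab)//|[Q i0Q ltQ]] := del b Ab.
(* As a != b, the classes A i0 :\ a and A i0 :\ b together cover A i0. *)
have subU : (S A (P :|: Q) <= S (D a) P + S (D b) Q)%VS.
  apply/subv_sumP => i iPQ; apply/subv_sumP => e Aie.
  have inP : i \in P -> e \in D a i -> (<[v e]> <= S (D a) P + S (D b) Q)%VS.
    move=> iP De; apply: subv_trans (addvSl _ _).
    by apply: (sumv_sup i) => //; apply: (sumv_sup e).
  have inQ : i \in Q -> e \in D b i -> (<[v e]> <= S (D a) P + S (D b) Q)%VS.
    move=> iQ De; apply: subv_trans (addvSr _ _).
    by apply: (sumv_sup i) => //; apply: (sumv_sup e).
  case: (eqVneq i i0) => [ii0|nii0]; last first.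
    by case/setUP: iPQ => [/inP|/inQ]; apply; rewrite /D (negPf nii0).
  subst i; have [ea|nea] := eqVneq e a.
    by apply: inQ => //; rewrite /D eqxx !inE Aie ea neq_ab.
  by apply: inP => //; rewrite /D eqxx !inE Aie nea.
have subI : (S A ((P :&: Q) :\ i0) <= S (D a) P :&: S (D b) Q)%VS.
  rewrite subv_cap; apply/andP; split; apply/subv_sumP => i;
    rewrite !inE => /and3P[/negPf nii0 iP iQ];
    by apply: (sumv_sup i) => //; rewrite /D nii0.
have := dimv_sum_cap (S (D a) P) (S (D b) Q).
have := leq_trans (radoA _) (dimvS subU); have := leq_trans (radoA _) (dimvS subI).
have := cardsD1 i0 (P :&: Q); rewrite !inE i0P i0Q.
have := cardsUI P Q.
by move: ltP ltQ; lia.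
Qed.

(** * Two facts on rational numbers *)

(** The ratio test of linear programming: [t] is the least ratio [a j / b j]
over the constraints with [0 < b j], and a constraint that attains it blocks. *)
Lemma affine_blocking (J : finType) (a b : J -> rat) (j0 : J) :
  (forall j, 0 <= a j) -> (forall j, 0 < b j -> 0 < a j) -> 0 < b j0 ->
  exists2 t : rat, 0 < t &
    (forall j, t * b j <= a j) /\ exists2 j, 0 < b j & a j = t * b j.
Proof.
move=> a_ge0 ab bj0.
case: (arg_minP (P := fun j => 0 < b j) (fun j => a j / b j) bj0) => j bj minj.
exists (a j / b j); first by rewrite divr_gt0 ?ab.
split=> [i|]; last by exists j => //; rewrite divfK ?gt_eqF.
have [bi|bi] := ltP 0 (b i); first by rewrite -ler_pdivlMr ?minj.
by rewrite (le_trans _ (a_ge0 i)) // mulr_ge0_le0 // divr_ge0 // ltW.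
Qed.

Lemma common_denominator (J : finType) (c : J -> rat) :
  (forall j, 0 <= c j) ->
  exists2 N : nat, (0 < N)%N &
    exists m : J -> nat, forall j, c j * N%:R = (m j)%:R.
Proof.
move=> c_ge0; exists (\prod_j `|denq (c j)|)%N.
  by rewrite prodn_gt0 // => j; rewrite absz_gt0 denq_neq0.
exists (fun j => `|numq (c j)| * \prod_(i | i != j) `|denq (c i)|)%N => j.
rewrite (bigD1 j) //= !natrM mulrA; congr (_ * _).
rewrite !natr_absz ger0_norm ?denq_ge0 // ger0_norm ?numq_ge0 //.
by rewrite numqE.
Qed.

(** * Feasible weights and degeneration along a tight subspace *)

Definition mass (K : fieldType) (vT : vectType K) (E : finType)
    (v : E -> vT) (x : E -> rat) (W : {vspace vT}) : rat :=
  \sum_(e | v e \in W) x e.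

Definition feasible (K : fieldType) (vT : vectType K) (I E : finType)
    (cls : E -> I) (v : E -> vT) (x : E -> rat) (k : rat) : Prop :=
  [/\ forall e, 0 <= x e,
      forall i, \sum_(e | cls e == i) x e = k &
      forall W : {vspace vT}, mass v x W <= k * (\dim W)%:R].

(** The dimension condition expresses linear independence of the chosen vectors;
they form a basis when [#|I|] is the dimension of the space. *)
Definition transversal_basis (K : fieldType) (vT : vectType K) (I E : finType)
    (cls : E -> I) (v : E -> vT) (T : {ffun I -> E}) : bool :=
  [forall i, cls (T i) == i] && (#|I| <= \dim (\sum_i <[v (T i)]>)%VS)%N.

Definition hits (K : fieldType) (vT : vectType K) (I E : finType)
    (v : E -> vT) (T : {ffun I -> E}) (W : {vspace vT}) : nat :=
  #|[set i | v (T i) \in W]|.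

(** The image of [v e] in the graded space [W + V / W] of the flag
[0 <= W <= V], with the complement [W^C] standing for [V / W]. *)
Definition degen (K : fieldType) (vT : vectType K) (E : finType)
    (W : {vspace vT}) (v : E -> vT) (e : E) : vT :=
  if v e \in W then v e else v e - projv W (v e).

Lemma feasible_ge0 (K : fieldType) (vT : vectType K) (I E : finType)
    (cls : E -> I) (v : E -> vT) (x : E -> rat) (k : rat) (i : I) :
  feasible cls v x k -> 0 <= k.
Proof. by case=> x_ge0 xk _; rewrite -(xk i) sumr_ge0. Qed.

(** The degenerate vectors in [U] lie in [U :&: W] or in [U :&: W^C].  The former
come from vectors in [U :&: W]; the latter from vectors outside [W] that lie in
[W + (U :&: W^C)], whose weight is at most [k * \dim (U :&: W^C)] since [W]
already carries its full share [k * \dim W]. *)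
Lemma degen_feasible (K : fieldType) (vT : vectType K) (I E : finType)
    (cls : E -> I) (v : E -> vT) (x : E -> rat) (k : rat) (i : I)
    (W : {vspace vT}) :
  feasible cls v x k -> mass v x W = k * (\dim W)%:R ->
  feasible cls (degen W v) x k.
Proof.
move=> fx; have k_ge0 := feasible_ge0 i fx; case: fx => x_ge0 xk massx tightW.
split=> // U; rewrite /mass (bigID (fun e => v e \in W)) /=.
have inW : \sum_(e | (degen W v e \in U) && (v e \in W)) x e
    <= k * (\dim (U :&: W))%:R.
  apply: le_trans (massx _); rewrite le_eqVlt; apply/orP; left; apply/eqP.
  apply: eq_bigl => e; rewrite memv_cap /degen andbC [RHS]andbC.
  by case: (v e \in W).
have outW : \sum_(e | (degen W v e \in U) && (v e \notin W)) x e
    <= k * (\dim (U :&: W^C))%:R.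
  have := massx (W + (U :&: W^C))%VS.
  rewrite dimv_disjoint_sum; last first.
    by rewrite capvC -capvA [(W^C :&: W)%VS]capvC capv_compl capv0.
  rewrite natrD mulrDr -tightW {1}/mass (bigID (fun e => v e \in W)) /=.
  have -> : \sum_(e | (v e \in (W + (U :&: W^C))%VS) && (v e \in W)) x e = mass v x W.
    apply: eq_bigl => e; apply: andb_idl; exact: (subvP (addvSl _ _)).
  rewrite lerD2l; apply: le_trans; rewrite [leRHS]big_mkcond [leLHS]big_mkcond /=.
  apply: ler_sum => e _; rewrite /degen; case: (boolP (v e \in W)) => vW.
    by rewrite !andbF.
  case: (boolP (v e - _ \in U)) => vU; last by case: ifP.
  rewrite ifT // andbT -[v e](addrNK (projv W (v e))) addrC memv_add ?memv_proj //.
  by rewrite memv_cap vU memv_projC.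
apply: le_trans (lerD inW outW) _; rewrite -mulrDr ler_wpM2l // -natrD ler_nat.
rewrite -dimv_disjoint_sum.
  by apply: dimvS; rewrite subv_add !capvSl.
by apply/eqP; rewrite -subv0 -(capv_compl W) capvS ?capvSr.
Qed.

(** A basis of homogeneous vectors contains exactly [\dim W] vectors of [W], which
generate [W].  Modulo these, undoing the projections changes nothing, so the
original vectors still generate the whole space. *)
Lemma degen_basis (K : fieldType) (vT : vectType K) (I E : finType)
    (cls : E -> I) (v : E -> vT) (W : {vspace vT}) (T : {ffun I -> E}) :
  #|I| = \dim {:vT} -> transversal_basis cls (degen W v) T ->
  transversal_basis cls v T /\ hits v T W = \dim W.
Proof.
move=> cardI /andP[clsT dimT]; rewrite /transversal_basis clsT /=.
pose H := [set i | v (T i) \in W].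
pose X := (\sum_(i in H) <[v (T i)]>)%VS.
pose Y := (\sum_(i in ~: H) <[v (T i) - projv W (v (T i))]>)%VS.
have defD : (\sum_i <[degen W v (T i)]> = X + Y)%VS.
  rewrite (bigID (mem H)) /=; congr (_ + _)%VS.
    by apply: eq_bigr => i; rewrite inE /degen => ->.
  by apply: eq_big => [i|i]; rewrite !inE /degen // => /negPf->.
have XW : (X <= W)%VS.
  by apply/subv_sumP => i; rewrite inE.
have YW : (Y <= W^C)%VS.
  by apply/subv_sumP => i _; apply: memv_projC.
have dsum (P : {set I}) (u : I -> vT) : (\dim (\sum_(i in P) <[u i]>)%VS <= #|P|)%N.
  rewrite -sum1_card (leq_trans (dimv_leq_sum _ _ _)) //.
  by apply: leq_sum => i _; rewrite dim_vline leq_b1.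
have := dsum H (v \o T); have := dsum (~: H) (fun i => v (T i) - projv W (v (T i))).
rewrite -/X -/Y => leY leX.
have := cardsC H; have := dimvS XW; have := dimvS YW.
have : (\dim (X + Y) <= \dim X + \dim Y)%N by apply: dimv_add_leqif.
rewrite defD cardI in dimT; rewrite dimv_compl -cardI => *.
have dW : (\dim W <= #|I|)%N by rewrite cardI dimvS ?subvf.
split; last by rewrite /hits -/H; lia.
rewrite cardI (leq_trans dimT) //; apply: dimvS.
have eqXW : X = W by apply/eqP; rewrite eqEdim XW; lia.
have XS : (X <= \sum_i <[v (T i)]>)%VS.
  by apply/subv_sumP => i _; apply: (sumv_sup i).
rewrite subv_add XS; apply/subv_sumP => i _; rewrite -memvE rpredB //.
  by rewrite memvE; apply: (sumv_sup i).
by apply: (subvP XS); rewrite eqXW memv_proj.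
Qed.

(** * Removing a transversal basis from a weight *)

(** Rado's condition for the supports of the classes: the elements of positive
weight in the classes of [P] have total weight [k * #|P|], and this is at most [k]
times the dimension of their span. *)
Lemma supported_transversal_basis (K : fieldType) (vT : vectType K)
    (I E : finType) (cls : E -> I) (v : E -> vT) (x : E -> rat) (k : rat) :
  0 < k -> feasible cls v x k ->
  exists2 T, transversal_basis cls v T & forall i, 0 < x (T i).
Proof.
move=> k_gt0 [x_ge0 xk massx].
pose A i := [set e | (cls e == i) && (0 < x e)].
have [P|T [TA dimT]] := rado_transversal (v := v) (A := A).
  set W := (\sum_(i in P) _)%VS; rewrite -(ler_nat rat) -(ler_pM2l k_gt0).
  apply: le_trans (massx W).
  have -> : k * #|P|%:R = \sum_(i in P) \sum_(e | cls e == i) x e.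
    rewrite (eq_bigr (fun=> k)) => [|i _]; last exact: xk.
    by rewrite sumr_const mulr_natr.
  rewrite (exchange_big_dep predT) //= /mass [leRHS]big_mkcond /=.
  apply: ler_sum => e _; have [vW|vW] := boolP (v e \in W).
    have [ieP|ieP] := boolP (cls e \in P).
      by rewrite (bigD1 (cls e)) ?ieP ?eqxx //= big1 ?addr0 // => i;
        case: eqVneq; rewrite ?andbF.
    by rewrite big1 // => i /andP[iP /eqP ie]; rewrite ie iP in ieP.
  rewrite big1 // => i /andP[iP ie]; apply/eqP; rewrite eq_le x_ge0 andbT leNgt.
  apply: contra vW => xe; rewrite memvE; apply: (sumv_sup i) => //.
  by apply: (sumv_sup e); rewrite ?inE ?ie.
exists T => [|i]; last by have := TA i; rewrite inE => /andP[].
by rewrite /transversal_basis dimT andbT; apply/forallP => i;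
  have := TA i; rewrite inE => /andP[].
Qed.

Definition spanset (K : fieldType) (vT : vectType K) (E : finType)
    (v : E -> vT) (S : {set E}) : {vspace vT} := (\sum_(e in S) <[v e]>)%VS.

(** For a transversal [T], the test [T (cls e) == e] says that [T] selects [e]. *)
Definition peel (I E : finType) (cls : E -> I) (T : {ffun I -> E})
    (t : rat) (x : E -> rat) (e : E) : rat :=
  x e - t * (T (cls e) == e)%:R.

Lemma sum_transversal (I E : finType) (cls : E -> I) (T : {ffun I -> E})
    (P : pred E) :
  (forall i, cls (T i) = i) ->
  \sum_(e | P e) (T (cls e) == e)%:R = #|[set i | P (T i)]|%:R :> rat.
Proof.
move=> clsT; rewrite -natr_sum; congr _%:R.
rewrite -big_mkcondr /= (reindex_onto T cls) => [|e /andP[_ /eqP //]].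
by rewrite sum1dep_card; apply: eq_card => i; rewrite !inE clsT !eqxx !andbT.
Qed.

Lemma mass_peel (K : fieldType) (vT : vectType K) (I E : finType)
    (cls : E -> I) (v : E -> vT) (x : E -> rat) (T : {ffun I -> E}) (t : rat)
    (W : {vspace vT}) :
  (forall i, cls (T i) = i) ->
  mass v (peel cls T t x) W = mass v x W - t * (hits v T W)%:R.
Proof.
by move=> clsT; rewrite /mass sumrB -mulr_sumr sum_transversal.
Qed.

(** The number [t] comes from the ratio test on the constraints of [feasible];
those on subspaces need only be imposed on spans of sets of vectors, which are
finitely many. *)
Lemma feasible_peel (K : fieldType) (vT : vectType K) (I E : finType)
    (cls : E -> I) (v : E -> vT) (x : E -> rat) (k : rat) (i0 : I)
    (T : {ffun I -> E}) :
  feasible cls v x k -> transversal_basis cls v T -> (forall i, 0 < x (T i)) ->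
  (forall S, mass v x (spanset v S) = k * (\dim (spanset v S))%:R ->
     hits v T (spanset v S) = \dim (spanset v S)) ->
  exists2 t, 0 < t &
    feasible cls v (peel cls T t x) (k - t) /\
    ((exists i, x (T i) = t) \/
     exists2 W, mass v (peel cls T t x) W = (k - t) * (\dim W)%:R &
       hits v T W <> \dim W).
Proof.
case=> x_ge0 xk massx /andP[/forallP clsT' _] xT tightT.
have clsT i : cls (T i) = i by apply/eqP.
pose a (j : E + {set E}) := match j with
  | inl e => x e
  | inr F => k * (\dim (spanset v F))%:R - mass v x (spanset v F) end.
pose b (j : E + {set E}) : rat := match j with
  | inl e => (T (cls e) == e)%:R
  | inr F => (\dim (spanset v F))%:R - (hits v T (spanset v F))%:R end.
have [|||t t_gt0 [tba [j bj aj]]] := @affine_blocking _ a b (inl (T i0)).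
- by case=> [e|S] /=; rewrite ?subr_ge0.
- case=> [e|S] /=.
    by case: eqP => [<-|]; rewrite ?ltxx ?xT.
  rewrite !subr_gt0 => lt_hits; rewrite lt_neqAle massx andbT.
  by apply: contraTneq lt_hits => /tightT->; rewrite ltxx.
- by rewrite /= clsT eqxx.
have x'_ge0 e : 0 <= peel cls T t x e by rewrite subr_ge0 (tba (inl e)).
have x'k i : \sum_(e | cls e == i) peel cls T t x e = k - t.
  rewrite sumrB xk -mulr_sumr sum_transversal // (_ : [set _ | _] = [set i]).
    by rewrite cards1 mulr1.
  by apply/setP => j'; rewrite !inE clsT.
have kt_ge0 : 0 <= k - t by rewrite -(x'k i0) sumr_ge0.
exists t => //; split.
  split=> // W; set S := [set e | v e \in W].
  have SW : (spanset v S <= W)%VS by apply/subv_sumP => e; rewrite inE.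
  have -> : mass v (peel cls T t x) W = mass v (peel cls T t x) (spanset v S).
    apply: eq_bigl => e; apply/idP/idP; last exact: (subvP SW).
    by move=> vW; rewrite memvE; apply: (sumv_sup e); rewrite ?inE.
  apply: le_trans (_ : (k - t) * (\dim (spanset v S))%:R <= _).
    by have := tba (inr S); rewrite mass_peel //=; lra.
  by rewrite ler_wpM2l // ler_nat dimvS.
case: j bj aj => [e|S] /=.
  by case: eqP => [Te _ xe|]; [left; exists (cls e); rewrite Te xe mulr1 | rewrite ltxx].
rewrite subr_gt0 ltr_nat => lt_hits aS; right; exists (spanset v S).
  by rewrite mass_peel //; lra.
by move=> eqh; rewrite eqh ltnn in lt_hits.
Qed.

Definition support_bases (K : fieldType) (vT : vectType K) (I E : finType)
    (cls : E -> I) (v : E -> vT) (x : E -> rat) : {set {ffun I -> E}} :=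
  [set T | transversal_basis cls v T && [forall i, 0 < x (T i)]].

Definition conic_comb (K : fieldType) (vT : vectType K) (I E : finType)
    (cls : E -> I) (v : E -> vT) (x : E -> rat) : Prop :=
  exists c : {ffun I -> E} -> rat,
    [/\ forall T, 0 <= c T,
        forall T, c T != 0 -> transversal_basis cls v T &
        forall e, x e = \sum_(T : {ffun I -> E} | T (cls e) == e) c T].

Lemma conic_comb_peel (K : fieldType) (vT : vectType K) (I E : finType)
    (cls : E -> I) (v : E -> vT) (x : E -> rat) (T : {ffun I -> E}) (t : rat) :
  0 < t -> transversal_basis cls v T ->
  conic_comb cls v (peel cls T t x) -> conic_comb cls v x.
Proof.
move=> t_gt0 tbT [c [c_ge0 cb cx]].
exists (fun T' => c T' + t * (T' == T)%:R); split=> [T'|T'|e].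
- by rewrite addr_ge0 ?mulr_ge0 ?ler0n // ltW.
- by case: (eqVneq T' T) => [->|_] //; rewrite mulr0 addr0 => /cb.
rewrite big_split /= -cx -mulr_sumr /peel.
suff -> : \sum_(T' : {ffun I -> E} | T' (cls e) == e) (T' == T)%:R
    = (T (cls e) == e)%:R :> rat by rewrite subrK.
rewrite -natr_sum big_mkcond (bigD1 T) //= big1 => [|T' /negPf->]; last by case: ifP.
by rewrite eqxx addn0; case: eqP.
Qed.

(** * Decomposition of feasible weights *)

(** Induction on the number of transversal bases in the support of [x].
Degenerating along a tight subspace that some of them meets in too few elements
strictly decreases this number, and so does removing a multiple of [T] that
exhausts a coordinate.  If the removal is blocked by a subspace that has become
tight instead, the number is unchanged but the degeneration applies next. *)
Theorem feasible_conic_comb (K : fieldType) (vT : vectType K) (I E : finType)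
    (cls : E -> I) (v : E -> vT) (x : E -> rat) (k : rat) (i0 : I) :
  #|I| = \dim {:vT} -> feasible cls v x k -> conic_comb cls v x.
Proof.
move=> cardI; have [m] := ubnP #|support_bases cls v x|.
elim: m v x k => // m IHm v x k ltm fx.
have degenerate y l W T : feasible cls v y l ->
    support_bases cls v y \subset support_bases cls v x ->
    mass v y W = l * (\dim W)%:R -> T \in support_bases cls v y ->
    hits v T W <> \dim W -> conic_comb cls v y.
  move=> fy suby tightW Ty hitsT.
  have ltd : (#|support_bases cls (degen W v) y| < m)%N.
    rewrite -ltnS (leq_trans _ ltm) // ltnS (leq_trans _ (subset_leq_card suby)) //.
    apply: proper_card; apply/properP; split.
      by apply/subsetP => T'; rewrite !inE => /andP[dT ->]; have [->] := degen_basis cardI dT.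
    exists T => //; apply/negP; rewrite inE => /andP[dT _].
    by have [_ /hitsT] := degen_basis cardI dT.
  have [c [c_ge0 cb cy]] := IHm _ _ _ ltd (degen_feasible i0 fy tightW).
  by exists c; split=> // T' /cb dT; have [] := degen_basis cardI dT.
have k_ge0 := feasible_ge0 i0 fx.
have [k0|k_neq0] := eqVneq k 0.
  case: fx => x_ge0 xk _; exists (fun=> 0); split=> [T|T|e]; rewrite ?eqxx //.
  rewrite big1 //; apply/eqP; rewrite eq_le x_ge0 andbT -k0 -(xk (cls e)).
  by rewrite (bigD1 e) //= lerDl sumr_ge0.
have k_gt0 : 0 < k by rewrite lt_def k_neq0.
have [T tbT xT] := supported_transversal_basis k_gt0 fx.
have Tx : T \in support_bases cls v x by rewrite inE tbT; apply/forallP.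
have [/forallP tightT|] := boolP [forall S : {set E},
    (mass v x (spanset v S) == k * (\dim (spanset v S))%:R) ==>
    (hits v T (spanset v S) == \dim (spanset v S))]; last first.
  rewrite negb_forall => /existsP[S]; rewrite negb_imply => /andP[/eqP tS /eqP hS].
  exact: degenerate fx _ tS Tx hS.
have [|t t_gt0 [fx' blocked]] := feasible_peel i0 fx tbT xT.
  by move=> S /eqP tS; have := tightT S; rewrite tS => /eqP.
apply: (conic_comb_peel t_gt0 tbT).
have sub' : support_bases cls v (peel cls T t x) \subset support_bases cls v x.
  apply/subsetP => T'; rewrite !inE => /andP[-> /forallP x'T'] /=.
  apply/forallP => i; rewrite (lt_le_trans (x'T' i)) // gerBl mulr_ge0 ?ler0n //.
  exact: ltW.
have [Tx'|Tx'] := boolP (T \in support_bases cls v (peel cls T t x)).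
  case: blocked => [[i xTi]|[W tW hW]]; last exact: degenerate fx' sub' tW Tx' hW.
  move: Tx'; rewrite inE => /andP[/andP[/forallP/(_ i)/eqP clsT _] /forallP/(_ i)].
  by rewrite /peel clsT eqxx mulr1 xTi subrr ltxx.
apply: IHm fx'; rewrite -ltnS (leq_trans _ ltm) // ltnS; apply: proper_card.
by apply/properP; split=> //; exists T.
Qed.

(** * Families of bases *)

Lemma free_count_le_dim (K : fieldType) (vT : vectType K) (X : seq vT)
    (W : {vspace vT}) :
  free X -> (count (mem W) X <= \dim W)%N.
Proof.
move=> freeX; have := filter_free (mem W) freeX.
rewrite -size_filter => /eqP <-; apply: dimvS; apply/span_subvP => u.
by rewrite mem_filter => /andP[].
Qed.

Lemma feasible_bases (K : fieldType) (vT : vectType K) (n : nat)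
    (B : 'I_n -> n.-tuple vT) :
  (forall i, free (B i)) ->
  feasible (fun e : 'I_n * 'I_n => e.1) (fun e => tnth (B e.1) e.2)
    (fun=> 1) n%:R.
Proof.
move=> freeB; split=> // [i|W].
  rewrite (eq_bigl (fun e => (e.1 == i) && predT e.2)) => [|e]; last by rewrite andbT.
  by rewrite -(pair_big (pred1 i) predT (fun _ _ => 1)) /= big_pred1_eq sumr_const card_ord.
rewrite /mass -(pair_big_dep predT (fun i j => tnth (B i) j \in W) (fun _ _ => 1)) /=.
apply: le_trans (_ : \sum_(i < n) (\dim W)%:R <= _).
  apply: ler_sum => i _; have := free_count_le_dim W (freeB i).
  by rewrite -(ler_nat rat) -sum1_count natr_sum big_tuple.
by rewrite sumr_const card_ord mulr_natl.
Qed.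

Theorem theorem2 (R : realType) (n : nat) (hn : (0 < n)%N)
    (B : 'I_n -> n.-tuple 'cV[R[i]]_n)
    (hB : forall i : 'I_n, basis_of {:'cV[R[i]]_n} (B i)) :
  exists (l : nat) (A : 'M['cV[R[i]]_n]_(n, (l * n)%N)),
    [/\ (1 <= l)%N,
        forall i : 'I_n,
          (forall j : 'I_(l * n), A i j \in B i) /\
          (forall v : 'cV[R[i]]_n, v \in B i ->
             #|[set j : 'I_(l * n) | A i j == v]| = l)
      & forall j : 'I_(l * n),
          basis_of {:'cV[R[i]]_n} [tuple A i j | i < n]].
Proof.
have freeB i : free (B i) by apply: basis_free (hB i).
have dimV : \dim {:'cV[R[i]]_n} = n by rewrite dimvf /dim /= muln1.
pose i0 := Ordinal hn.
pose v (e : 'I_n * 'I_n) := tnth (B e.1) e.2.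
have [|c [c_ge0 cb cx]] := feasible_conic_comb i0 _ (feasible_bases freeB).
  by rewrite card_ord dimV.
have [N N_gt0 [m cm]] := common_denominator c_ge0.
pose s := flatten [seq nseq (m T) T | T <- enum {ffun 'I_n -> 'I_n * 'I_n}].
have count_s (P : pred {ffun 'I_n -> 'I_n * 'I_n}) : count P s = (\sum_(T | P T) m T)%N.
  rewrite count_flatten -map_comp sumnE big_map big_enum /= [RHS]big_mkcond /=.
  by apply: eq_bigr => T _; rewrite count_nseq; case: (P T); rewrite ?mul1n.
have count_e i k : count (fun T : {ffun 'I_n -> 'I_n * 'I_n} => T i == (i, k)) s = N.
  apply/eqP; rewrite -(eqr_nat rat) count_s natr_sum.
  rewrite -[N%:R]mul1r [X in _ == X * _](cx (i, k)) mulr_suml.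
  by apply/eqP/eq_bigr => T _; rewrite cm.
have s_basis T : T \in s -> transversal_basis (fun e : 'I_n * 'I_n => e.1) v T.
  case/flattenP => _ /mapP[T' _ ->]; rewrite mem_nseq => /andP[mT' /eqP->].
  apply: cb; apply: contraTneq mT' => cT'; have := cm T'.
  by rewrite cT' mul0r => /esym/eqP; rewrite pnatr_eq0 => /eqP->.
have fst_s T i : T \in s -> T i = (i, (T i).2).
  by case/s_basis/andP => /forallP/(_ i)/eqP + _; case: (T i) => a b /= ->.
(* Each column selects one of the n elements in row i0, each selected N times. *)
have size_s : size s == (N * n)%N.
  rewrite -sum1_size (eq_big_seq (fun T : {ffun 'I_n -> 'I_n * 'I_n} =>
    \sum_k (T i0 == (i0, k)))%N) => [|T Ts].
    rewrite exchange_big /= (eq_bigr (fun=> N)) => [|k _].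
      by rewrite sum_nat_const card_ord mulnC.
    by rewrite -(count_e i0 k) -sum1_count [RHS]big_mkcond.
  rewrite (bigD1 (T i0).2) //= -fst_s // eqxx big1 // => k /negPf neq_k.
  by rewrite fst_s // xpair_eqE eqxx eq_sym neq_k.
pose t := Tuple size_s.
have t_s j : tnth t j \in s by apply: mem_tnth.
exists N, (\matrix_(i, j) v (tnth t j i)); split=> // [i|j].
  split=> [j|u].
    by rewrite mxE /v fst_s // mem_tnth.
  case/tnthP => k ->; rewrite -[RHS](count_e i k) -sum1_count (big_tuple _ _ t) sum1dep_card.
  apply: eq_card => j; rewrite !inE mxE /v [tnth t j i]fst_s //= xpair_eqE eqxx /=.
  have /tuple_uniqP injB := free_uniq (freeB i).
  by rewrite (inj_eq injB).
rewrite basisEdim size_tuple dimV leqnn andbT.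
have /andP[_] := s_basis _ (t_s j); rewrite card_ord => dimT.
have -> : (<<[tuple (\matrix_(i, j) v (tnth t j i)) i j | i < n]>>
    = \sum_i <[v (tnth t j i)]>)%VS.
  rewrite span_def big_tuple; apply: eq_bigr => i _.
  by rewrite tnth_mktuple mxE.
by rewrite -(geq_leqif (dimv_leqif_sup (subvf _))) dimV.
Qed.
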